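(* Let $N\geqslant 1$. There is a dense $G_\delta$ subset $\mathcal A$ of the space $\mathcal K(\mathbb R^N)$ such that each $X\in\mathcal A$ is a Cantor set and, for every linear subspace $L\subset\mathbb R^N$ with $L\neq\{0\}$, the orthogonal projection of $X$ into $L$ is a Cantor set.
   Context: A Cantor set is any topological space homeomorphic to the standard middle-thirds Cantor set. $\mathcal K(\mathbb R^N)$ is the space of all non-empty compact subsets of $\mathbb R^N$, endowed with the Hausdorff metric $d_H(X,Y)=\inf\{\varepsilon>0 \mid X\subset O(Y,\varepsilon),\ Y\subset O(X,\varepsilon)\}$, where $O(X,\varepsilon)=\{y\in\mathbb R^N\mid d(y,X)<\varepsilon\}$ and $d$ is the Euclidean distance. *)

(* Defs.v *)
From HB Require Import structures.
From mathcomp Require Import all_boot all_order all_algebra.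
From mathcomp Require Import all_classical all_reals all_analysis.
From mathcomp Require Import ring lra.

Set Implicit Arguments.
Unset Strict Implicit.
Unset Printing Implicit Defensive.

Import Order.TTheory GRing.Theory Num.Theory.
Import numFieldNormedType.Exports.

Local Open Scope classical_set_scope.
Local Open Scope ring_scope.

Section euclidean.
Context {R : realType} {N : nat}.
Implicit Types (u v w x y z : 'rV[R]_N) (L : {vspace 'rV[R]_N}).

Definition dotp u v : R := \sum_(i < N) u 0 i * v 0 i.

Lemma dotpC u v : dotp u v = dotp v u.
Proof. by apply: eq_bigr => i _; rewrite mulrC. Qed.

Lemma dotp_bilinear : bilinear_for
  (GRing.Scale.Law.clone _ _ *%R _) (GRing.Scale.Law.clone _ _ *%R _) dotp.
Proof.
have lin w a u v : dotp (a *: u + v) w = a * dotp u w + dotp v w.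
  rewrite /dotp mulr_sumr -big_split/=; apply: eq_bigr => i _.
  by rewrite !mxE mulrDl mulrA.
by split=> [w a u v | w a u v] /=; rewrite ?lin// dotpC lin ![dotp _ w]dotpC.
Qed.

HB.instance Definition _ := bilinear_isBilinear.Build R _ _ R
  (GRing.Scale.Law.clone _ _ *%R _) (GRing.Scale.Law.clone _ _ (idfun \; *%R) _)
  dotp dotp_bilinear.

Fact dotp_sym u v : dotp u v = (-1) ^+ false * idfun (dotp v u).
Proof. by rewrite expr0 mul1r dotpC. Qed.

HB.instance Definition _ :=
  @isHermitianSesquilinear.Build R 'rV[R]_N false idfun dotp dotp_sym.

Fact dotp_gt0 u : u != 0 -> 0 < dotp u u.
Proof.
move=> u0; rewrite lt_def sumr_ge0 ?andbT; last first.
  by move=> i _; rewrite -expr2 sqr_ge0.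
apply: contra u0; rewrite psumr_eq0 => [/allP h|i _]; last first.
  by rewrite -expr2 sqr_ge0.
apply/eqP/rowP => i; rewrite mxE; apply/eqP.
by have := h i (mem_index_enum i); rewrite /= mulf_eq0 orbb.
Qed.

HB.instance Definition _ := isDotProduct.Build R 'rV[R]_N dotp dotp_gt0.

(* The projection onto L along its orthogonal complement, cf. orth_projP. *)
Definition orth_proj L : 'rV[R]_N -> 'rV[R]_N := daddv_pi L (orthov dotp L).

Definition enorm u : R := Num.sqrt (dotp u u).

Definition euclid_dist x y : R := enorm (x - y).

Definition set_dist x (Y : set 'rV[R]_N) : R :=
  inf [set euclid_dist x y | y in Y].

Definition fattening (X : set 'rV[R]_N) (e : R) : set 'rV[R]_N :=
  [set y | set_dist y X < e].

Definition hausdorff_dist (X Y : set 'rV[R]_N) : R :=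
  inf [set e | [/\ 0 < e, X `<=` fattening Y e & Y `<=` fattening X e]].

End euclidean.

Section euclidean_theory.
Context {R : realType} {N : nat}.
Implicit Types (u v w x y z : 'rV[R]_N) (L : {vspace 'rV[R]_N}).
Implicit Types (X Y Z : set 'rV[R]_N).

Lemma dotp_ge0 u : 0 <= dotp u u.
Proof. by apply: sumr_ge0 => i _; rewrite -expr2 sqr_ge0. Qed.

Lemma dotp_eq0 u : (dotp u u == 0) = (u == 0).
Proof.
have [->|u0] := eqVneq u 0; last by rewrite gt_eqF// dotp_gt0.
by rewrite /dotp big1 ?eqxx// => i _; rewrite mxE mul0r.
Qed.

Lemma dotpDl w u v : dotp (u + v) w = dotp u w + dotp v w.
Proof. exact: linearDl. Qed.

Lemma dotpZl w a u : dotp (a *: u) w = a * dotp u w.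
Proof. exact: linearZl_LR. Qed.

Lemma dotpBl w u v : dotp (u - v) w = dotp u w - dotp v w.
Proof. exact: linearBl. Qed.

Lemma dotpDr w u v : dotp w (u + v) = dotp w u + dotp w v.
Proof. exact: linearDr. Qed.

Lemma dotpZr w a u : dotp w (a *: u) = a * dotp w u.
Proof. exact: linearZr_LR. Qed.

Lemma dotpBr w u v : dotp w (u - v) = dotp w u - dotp w v.
Proof. exact: linearBr. Qed.

Lemma capv_orthov L : (L :&: orthov dotp L = 0)%VS.
Proof.
apply/eqP; rewrite -subv0; apply/subvP => u; rewrite memv_cap memv0.
by move=> /andP[uL /mem_orthovP/(_ _ uL)/eqP]; rewrite dotp_eq0.
Qed.

Lemma addv_orthov L : (L + orthov dotp L = fullv)%VS.
Proof.
have cap (k : nat) (s : nat -> 'rV[R]_N) :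
    (\dim {:'rV[R]_N} <= k + \dim (\bigcap_(i < k) orthov dotp <[s i]>))%N.
  elim: k => [|k IH]; first by rewrite big_ord0.
  rewrite big_ord_recr/=; apply: leq_trans IH _.
  rewrite addSnnS leq_add2l.
  have := leq_dim_orthov1 dotp (s k) (\bigcap_(i < k) orthov dotp <[s i]>).
  by case: (\dim (\bigcap_(i < k) _)).
have oE : orthov dotp L =
    (\bigcap_(i < \dim L) orthov dotp <[(vbasis L)`_i]>)%VS.
  by apply: eq_bigr => i _; rewrite orthov1E.
apply/eqP; rewrite eqEdim subvf/=.
have := dimv_sum_cap L (orthov dotp L).
rewrite capv_orthov dimv0 addn0 => ->; rewrite oE.
exact: (cap _ (fun i => (vbasis L)`_i)).
Qed.

Lemma orth_projP L x :
  orth_proj L x \in L /\ {in L, forall z, dotp (x - orth_proj L x) z = 0}.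
Proof.
split; first exact: memv_pi.
apply/mem_orthovP.
have xL : x \in (L + orthov dotp L)%VS by rewrite addv_orthov memvf.
by rewrite -[X in X - _](daddv_pi_add (capv_orthov L) xL) addrC addKr memv_pi.
Qed.

Lemma cauchy_schwarz u v : dotp u v <= enorm u * enorm v.
Proof.
rewrite -sqrtrM ?dotp_ge0//; apply: le_trans (ler_norm _) _.
rewrite -sqrtr_sqr ler_sqrt ?mulr_ge0 ?dotp_ge0//.
have [->|v0] := eqVneq v 0.
  have -> : dotp u 0 = 0 by rewrite /dotp big1// => i _; rewrite mxE mulr0.
  by rewrite expr0n mulr_ge0 ?dotp_ge0.
have := dotp_ge0 (dotp v v *: u - dotp u v *: v).
have -> : dotp (dotp v v *: u - dotp u v *: v) (dotp v v *: u - dotp u v *: v)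
    = dotp v v * (dotp u u * dotp v v - dotp u v ^+ 2).
  rewrite !(dotpBl, dotpBr, dotpZl, dotpZr) (dotpC v u).
  by ring.
by rewrite pmulr_rge0 ?dotp_gt0// subr_ge0.
Qed.

Lemma enorm_ge0 u : 0 <= enorm u. Proof. exact: sqrtr_ge0. Qed.

Lemma enormD u v : enorm (u + v) <= enorm u + enorm v.
Proof.
rewrite -(ler_pXn2r (n := 2))// ?nnegrE ?addr_ge0 ?enorm_ge0//.
rewrite sqrrD !sqr_sqrtr ?dotp_ge0// !(dotpDl, dotpDr) (dotpC v u).
have := cauchy_schwarz u v; lra.
Qed.

Lemma enormN u : enorm (- u) = enorm u.
Proof.
by congr Num.sqrt; apply: eq_bigr => i _; rewrite mxE mulrNN.
Qed.

Lemma coord_le_enorm u i : `|u 0 i| <= enorm u.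
Proof.
rewrite -sqrtr_sqr ler_sqrt ?dotp_ge0// /dotp (bigD1 i)//= -expr2 lerDl.
by apply: sumr_ge0 => j _; rewrite -expr2 sqr_ge0.
Qed.

Lemma euclid_distxx x : euclid_dist x x = 0.
Proof.
by apply/eqP; rewrite /euclid_dist subrr /enorm sqrtr_eq0 le_eqVlt dotp_eq0 eqxx.
Qed.

Lemma euclid_distC x y : euclid_dist x y = euclid_dist y x.
Proof. by rewrite /euclid_dist -enormN opprB. Qed.

Lemma euclid_dist_triangle y x z :
  euclid_dist x z <= euclid_dist x y + euclid_dist y z.
Proof. by rewrite /euclid_dist -(subrKA y) enormD. Qed.

Lemma euclid_dist_continuous x : continuous (euclid_dist x).
Proof.
move=> y; apply: (@continuous_comp _ _ _ (fun y => dotp (x - y) (x - y)));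
  last exact: sqrt_continuous.
apply: (@cvg_big R _ +%R 0 xpredT _ _ (nbhs y)) => [|i _].
  exact: add_continuous.
have c : (x - z) 0 i @[z --> y] --> (x - y) 0 i.
  have -> : (fun z => (x - z) 0 i) = (cst (x 0 i) \- (fun z => z 0 i)).
    by apply/funext => z; rewrite !mxE.
  rewrite !mxE; apply: (@cvgB R R^o _ (nbhs y)); first exact: cvg_cst.
  exact: coord_continuous.
exact: cvgM.
Qed.

Lemma set_dist_lt x Y (e : R) : Y !=set0 ->
  set_dist x Y < e <-> exists2 y, Y y & euclid_dist x y < e.
Proof.
move=> [y0 Yy0]; split.
  by move=> /inf_lt[|_ [y Yy <-]]; [exists (euclid_dist x y0), y0|exists y].
move=> [y Yy]; apply: le_lt_trans; apply: ge_inf; last by exists y.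
by exists 0 => _ [z _ <-]; exact: enorm_ge0.
Qed.

Lemma compact_fattening X Y : X !=set0 -> compact X -> Y !=set0 ->
  exists2 e : R, 0 < e & X `<=` fattening Y e.
Proof.
move=> X0 cX Y0; have [y Yy] := Y0.
have [|c cX' cmax] := compact_EVT_max (f := euclid_dist y) X0 cX.
  by apply: continuous_subspaceT; exact: euclid_dist_continuous.
exists (euclid_dist y c + 1); first by rewrite ltr_wpDl ?enorm_ge0.
move=> x Xx; apply/set_dist_lt => //; exists y => //.
by rewrite euclid_distC ltr_pwDr// cmax// inE.
Qed.

Lemma fattening_le X (e1 e2 : R) : e1 <= e2 ->
  fattening X e1 `<=` fattening X e2.
Proof. by move=> e12 x /lt_le_trans; apply. Qed.

Lemma hausdorff_dist_lt X Y (e : R) : X !=set0 -> compact X ->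
    Y !=set0 -> compact Y ->
  hausdorff_dist X Y < e <->
  exists2 d, d < e & [/\ 0 < d, X `<=` fattening Y d & Y `<=` fattening X d].
Proof.
move=> X0 cX Y0 cY; split.
  move=> /inf_lt[|d dS de]; last by exists d.
  have [d1 d10 XY] := compact_fattening X0 cX Y0.
  have [d2 d20 YX] := compact_fattening Y0 cY X0.
  exists (Num.max d1 d2); split; first by rewrite lt_max d10.
    by apply: subset_trans XY _; apply: fattening_le; rewrite le_max lexx.
  by apply: subset_trans YX _; apply: fattening_le; rewrite le_max lexx orbT.
move=> [d de dS]; apply: le_lt_trans de; apply: ge_inf => //.
by exists 0 => r [/ltW].
Qed.

Lemma fattening_trans X Y Z (e1 e2 : R) : Y !=set0 -> Z !=set0 ->
  X `<=` fattening Y e1 -> Y `<=` fattening Z e2 ->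
  X `<=` fattening Z (e1 + e2).
Proof.
move=> Y0 Z0 XY YZ x /XY/(set_dist_lt _ _ Y0)[y /YZ].
move=> /(set_dist_lt _ _ Z0)[z Zz yz] xy; apply/set_dist_lt => //.
exists z => //; apply: le_lt_trans (euclid_dist_triangle y x z) _.
exact: ltrD.
Qed.

Lemma rV_hausdorff : hausdorff_space 'rV[R]_N.
Proof.
rewrite ball_hausdorff => u v uv.
have [i uvi] : exists i, u 0 i != v 0 i.
  by apply/existsP; rewrite -negb_forall; apply: contra uv => /forallP h;
    apply/eqP/rowP => i; exact/eqP.
have d0 : 0 < `|u 0 i - v 0 i| / 2 by rewrite divr_gt0// normr_gt0 subr_eq0.
exists (PosNum d0, PosNum d0) => /=.
apply/eqP; rewrite -subset0 => w [] /= [_ /(_ 0 i)uw] [_ /(_ 0 i)vw].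
have := ball_triangle uw (ball_sym vw).
by rewrite /ball/= -splitr ltxx.
Qed.

Lemma fattening_closed X Y : Y !=set0 -> compact Y ->
  (forall e : R, 0 < e -> X `<=` fattening Y e) -> X `<=` Y.
Proof.
move=> Y0 cY h x Xx; apply: (compact_closed rV_hausdorff cY).
move=> B /nbhs_ballP[e /= e0 xeB].
have /set_dist_lt[//|y Yy xy] := h _ e0 _ Xx.
exists y; split=> //; apply: xeB; split=> // i j; rewrite ord1.
rewrite /ball/=; apply: le_lt_trans xy.
by have := coord_le_enorm (x - y) j; rewrite !mxE.
Qed.

End euclidean_theory.

(* Non-empty compact subsets of R^N. The library topology on 'rV[R]_N comes
   from the sup norm, which is equivalent to the Euclidean one. *)
Record hyperspace (R : realType) (N : nat) := Hyperspace {
  hyperspace_set :> set 'rV[R]_N ;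
  hyperspace_neq0 : hyperspace_set !=set0 ;
  hyperspace_compact : compact hyperspace_set }.

Section hyperspace_metric.
Context {R : realType} {N : nat}.
Local Notation K := (hyperspace R N).
Implicit Types X Y Z : K.

HB.instance Definition _ := gen_eqMixin K.
HB.instance Definition _ := gen_choiceMixin K.

Let dist X Y : R := hausdorff_dist X Y.

Let dist_lt X Y (e : R) : dist X Y < e <->
  exists2 d, d < e & [/\ 0 < d, X `<=` fattening Y d & Y `<=` fattening X d].
Proof.
by apply: hausdorff_dist_lt; [exact: hyperspace_neq0|exact: hyperspace_compact|
  exact: hyperspace_neq0|exact: hyperspace_compact].
Qed.

Let dist_ge0 X Y : 0 <= dist X Y.
Proof.
by rewrite leNgt; apply/negP => /dist_lt[d d0 []] /(lt_trans d0); rewrite ltxx.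
Qed.

Let distxx X : dist X X = 0.
Proof.
apply/eqP; rewrite eq_le dist_ge0 andbT; apply/ler_addgt0Pl => e e0.
rewrite addr0; apply: ge_inf; first by exists 0 => r [/ltW].
have XX : X `<=` fattening X e.
  move=> x Xx; apply/set_dist_lt; first exact: hyperspace_neq0.
  by exists x => //; rewrite euclid_distxx.
by split.
Qed.

Let dist_eq0 X Y : dist X Y = 0 -> X = Y.
Proof.
move=> XY; have XYE : X = Y :> set _.
  apply/seteqP; split; apply: fattening_closed => [||e e0];
    try exact: hyperspace_neq0; try exact: hyperspace_compact.
  - have /dist_lt[d /ltW/fattening_le de [_ + _]] : dist X Y < e by rewrite XY.
    by move=> /subset_trans; apply; exact: de.
  - have /dist_lt[d /ltW/fattening_le de [_ _]] : dist X Y < e by rewrite XY.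
    by move=> /subset_trans; apply; exact: de.
case: X Y XYE {XY} => [X X0 cX] [Y Y0 cY] /= XYE.
by subst Y; congr Hyperspace; exact: Prop_irrelevance.
Qed.

Let dist_sym X Y : dist X Y = dist Y X.
Proof.
by congr inf; apply/seteqP; split => e [].
Qed.

Let dist_triangle Y X Z : dist X Z <= dist X Y + dist Y Z.
Proof.
apply/ler_addgt0Pl => e e0; rewrite leNgt; apply/negP => XZ.
have e20 : 0 < e / 2 by rewrite divr_gt0.
have /dist_lt[d1 d1e [d10 XY YX]] : dist X Y < dist X Y + e / 2.
  by rewrite ltrDl.
have /dist_lt[d2 d2e [d20 YZ ZY]] : dist Y Z < dist Y Z + e / 2.
  by rewrite ltrDl.
have: dist X Z <= d1 + d2.
  apply: ge_inf; first by exists 0 => r [/ltW].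
  split; first exact: addr_gt0.
    by apply: fattening_trans XY YZ; exact: hyperspace_neq0.
  by rewrite addrC; apply: fattening_trans ZY YX; exact: hyperspace_neq0.
lra.
Qed.

HB.instance Definition _ :=
  isMetric.Build R K distxx dist_eq0 dist_sym dist_triangle.

Lemma hyperspace_mdistE X Y : mdist X Y = hausdorff_dist X Y.
Proof. by []. Qed.

End hyperspace_metric.

Fixpoint cantor_step {R : realType} (n : nat) : set R :=
  if n is m.+1 then
    [set x / 3 | x in cantor_step m] `|` [set (x + 2) / 3 | x in cantor_step m]
  else `[0, 1].

Definition middle_thirds (R : realType) : set R := \bigcap_n cantor_step n.
Arguments middle_thirds : clear implicits.

Definition homeomorphic (S T : topologicalType) : Prop :=
  exists (f : S -> T) (g : T -> S),
    [/\ cancel f g, cancel g f, continuous f & continuous g].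

(* set_type carries the topology induced by the ambient space. *)
Definition is_cantor_set (R : realType) (T : topologicalType) : Prop :=
  homeomorphic T (set_type (middle_thirds R)).

(* Main.v *)
Require Import Defs.
From HB Require Import structures.
From mathcomp Require Import all_boot all_order all_algebra.
From mathcomp Require Import all_classical all_reals all_analysis.
From mathcomp Require Import borel_hierarchy.
From mathcomp Require Import ring lra.

Set Implicit Arguments.
Unset Strict Implicit.
Unset Printing Implicit Defensive.

Import Order.TTheory GRing.Theory Num.Theory.
Import numFieldNormedType.Exports.

Local Open Scope classical_set_scope.
Local Open Scope ring_scope.

(* The set A consists of the compact sets which, for every n, have a
   neighbourhood all of whose members X satisfy
   - for all x in X and u <> 0, there is y in X with |x - y| < 1/(n+1) and
     <y, u> <> <x, u>;
   - for |u| <= n+1, every interval of length 1/(n+1) contains a point outside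
     <X, u>.
   These conditions are dense because a finite union of small simplices has them
   robustly: a small enough neighbourhood of m points cannot project onto an
   interval of given length, and the vertices of a simplex do not all lie close
   to a hyperplane. Since decreasing intersections of closed thickenings converge
   in the hyperspace, the Baire category argument applies.
   A point x and its projection onto L have the same product with any u in L.
   Hence the second condition separates two points p, q of the projection by a
   clopen set (take u = q - p), and the first one shows that the projection has
   no isolated point. *)

(** * Homeomorphisms and a criterion for being Cantor-like *)

Lemma homeomorphic_sym (S T : topologicalType) :
  homeomorphic S T -> homeomorphic T S.
Proof. by move=> [f [g [fK gK cf cg]]]; exists g, f. Qed.

Lemma homeomorphic_trans (S T U : topologicalType) :
  homeomorphic S T -> homeomorphic T U -> homeomorphic S U.
Proof.
move=> [f [g [fK gK cf cg]]] [f' [g' [fK' gK' cf' cg']]].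
exists (f' \o f), (g \o g'); split; try exact: can_comp.
- by move=> x; apply: continuous_comp; [exact: cf|exact: cf'].
- by move=> x; apply: continuous_comp; [exact: cg'|exact: cg].
Qed.

(* The library states its characterization of the Cantor space for pointed
   spaces; this alias makes any point of a space its base point. *)
Definition based_at (T : Type) (t : T) : Type := T.

HB.instance Definition _ (R : realType) (T : pseudoMetricType R) (t : T) :=
  PseudoMetric.copy (based_at t) T.
HB.instance Definition _ (R : realType) (T : pseudoMetricType R) (t : T) :=
  isPointed.Build (based_at t) t.

Lemma cantor_like_homeomorphic (R : realType) (T : pseudoMetricType R) (t : T) :
  cantor_like T -> homeomorphic T cantor_space.
Proof.
move=> clT.
have [f [cf clf]] := @homeomorphism_cantor_like R (based_at t) clT.
have fK : cancel f f^-1%FUN by move=> x; rewrite funK ?inE.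
have gK : cancel f^-1%FUN f by move=> x; rewrite invK ?inE.
exists f^-1%FUN, f; split => //.
apply/continuousP => A oA; rewrite -closedC.
(* Continuity of the inverse comes from [f] being a closed map: preimages under the inverse are
   images under [f]. *)
suff -> : ~` (f^-1%FUN @^-1` A) = f @` (~` A) by apply/clf; exact: open_closedC.
apply/seteqP; split=> [x nAx|_ [y nAy <-]] /=; last by rewrite fK.
by exists (f^-1%FUN x).
Qed.

(** The last hypothesis yields zero-dimensionality: as [f] misses the level [c] on [Y], the
    conditions f < c and f <= c agree there and cut out a clopen set. It is applied with plus or
    minus the identity on the line, and with products by a fixed vector. *)
Lemma cantor_like_set_type (R : realType) (T : pseudoMetricType R)
    (Y : set T) :
  hausdorff_space T -> compact Y ->
  (forall x (e : R), Y x -> 0 < e -> exists y, [/\ Y y, ball x e y & y != x]) ->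
  (forall x y, Y x -> Y y -> x != y -> exists f : T -> R, exists c : R,
     [/\ continuous f, f x < c, c < f y & forall z, Y z -> f z != c]) ->
  cantor_like (set_type Y).
Proof.
move=> hT cY pY sY.
have valc : continuous (set_val : Y -> T) by exact: initial_continuous.
split.
- apply/perfectTP => x ox.
  have : nbhs x [set x] by exact: open_nbhs_nbhs.
  move=> [_ [/= [W oW <-]] Wx sW].
  have : nbhs (set_val x) W by exact: open_nbhs_nbhs.
  move=> /nbhs_ballP[e /= e0 eW].
  have [y [Yy xy /negP]] := pY _ _ (set_valP x) e0; apply.
  apply/eqP; have := sW (SigSub (mem_set Yy)) (eW _ xy).
  by move=> /(congr1 val).
- move=> F FF _.
  have [|y [Yy cy]] := cY (set_val @ F).
    by apply: (@filterS _ F _ setT) => [x _|]; [exact: set_valP|exact: filterT].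
  exists (SigSub (mem_set Yy)); split=> // A B FA [_ [/= [W oW <-]] Wx sW].
  have [||_ [[x Ax <-] Wv]] := cy ((set_val : Y -> T) @` A) W.
  + by apply: (@filterS _ F _ A) FA => x Ax /=; exists x.
  + exact: open_nbhs_nbhs.
  by exists x; split => //; exact: sW.
- move=> x y xy; apply/val_inj/hT => A B Ax By.
  have [z [? ?]] := xy _ _ (valc x A Ax) (valc y B By).
  by exists (set_val z).
- move=> x y xy.
  have [||//|f [c [cf fx fy fc]]] := sY (set_val x) (set_val y).
  + exact: set_valP.
  + exact: set_valP.
  exists [set z | f (set_val z) < c]; split=> //.
    have cfv : continuous (f \o (set_val : Y -> T)).
      by move=> z; apply: continuous_comp; [exact: valc|exact: cf].
    split; first exact: (open_comp (fun z _ => cfv z) (@open_lt R c)).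
    have -> : [set z : Y | f (set_val z) < c] =
        (f \o (set_val : Y -> T)) @^-1` [set r | r <= c].
      apply/seteqP; split=> z /=; first exact: ltW.
      by rewrite le_eqVlt (negbTE (fc _ (set_valP z))).
    exact: (closed_comp (fun z _ => cfv z) (@closed_le R c)).
  by apply/negP; rewrite -leNgt ltW.
Qed.

(** * The middle-thirds set is Cantor-like *)

Section middle_thirds.
Context {R : realType}.
Implicit Types (x y c : R) (n : nat).

Lemma cantor_step01 n x : cantor_step n x -> 0 <= x <= 1.
Proof.
elim: n x => [x /=|n IH x /=]; first by rewrite in_itv.
by move=> [[y /IH ? <-]|[y /IH ? <-]]; lra.
Qed.

(** Preimages under the two contractions replace images, which makes closedness and inductions on
    [n] immediate. *)
Lemma cantor_stepS n x :
  cantor_step n.+1 x <-> cantor_step n (3 * x) \/ cantor_step n (3 * x - 2).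
Proof.
split=> [[[y cy <-]|[y cy <-]]|[cx|cx]].
- by left; congr cantor_step: cy; field.
- by right; congr cantor_step: cy; field.
- by left; exists (3 * x) => //; field.
- by right; exists (3 * x - 2) => //; field.
Qed.

Lemma cantor_step_le n x : cantor_step n.+1 x -> cantor_step n x.
Proof.
elim: n x => [x /cantor_step01|n IH x]; first by rewrite /= in_itv.
by move=> /cantor_stepS[] /IH ?; apply/cantor_stepS; [left|right].
Qed.

Lemma closed_cantor_step n : closed (cantor_step n : set R).
Proof.
elim: n => [|n IH]; first exact: itv_closed.
have -> : cantor_step n.+1 = (fun x => 3 * x) @^-1` cantor_step n `|`
    (fun x => 3 * x - 2) @^-1` (cantor_step n : set R).
  by apply/seteqP; split=> x /cantor_stepS.
have c3 : continuous (fun x => 3 * x) by exact: mulrl_continuous.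
apply: closedU; apply: closed_comp => // x _.
by apply: cvgB; [exact: c3|exact: cvg_cst].
Qed.

Lemma middle_thirds01 x : middle_thirds R x -> 0 <= x <= 1.
Proof. by move=> /(_ 0%N I)/cantor_step01. Qed.

Lemma compact_middle_thirds : compact (middle_thirds R).
Proof.
apply: (subclosed_compact _ (@segment_compact R 0 1)).
  by apply: closed_bigI => n _; exact: closed_cantor_step.
by move=> x /middle_thirds01; rewrite /= in_itv.
Qed.

Lemma middle_thirdsP x :
  middle_thirds R x <-> middle_thirds R (3 * x) \/ middle_thirds R (3 * x - 2).
Proof.
split=> [mx|[] mx n _]; last 2 first.
- by apply: cantor_step_le; apply/cantor_stepS; left; exact: mx.
- by apply: cantor_step_le; apply/cantor_stepS; right; exact: mx.
(* The branch must be the same for all [n]. The position of [x] relative to 1/2 decides it: either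
   3x - 2 < 0 or 3x > 1, which rules out the other branch at every step. *)
have [x1|x1] := leP x (1 / 2); [left|right] => n _.
  by have /cantor_stepS[//|/cantor_step01] := mx n.+1 I; lra.
by have /cantor_stepS[/cantor_step01|//] := mx n.+1 I; lra.
Qed.

Lemma middle_thirds_ends : middle_thirds R 0 /\ middle_thirds R 1.
Proof.
suff h n : cantor_step n (0 : R) /\ cantor_step n (1 : R).
  by split=> n _; have [] := h n.
elim: n => [|n [IH0 IH1]]; first by rewrite /= !in_itv/=; lra.
split; apply/cantor_stepS; [left|right]; first by rewrite mulr0.
by congr cantor_step: IH1; lra.
Qed.

(** The other point is an endpoint 0 or 1 for [n] = 0, and is then carried through the contractions,
    each dividing distances by 3. *)
Lemma middle_thirds_close n x : middle_thirds R x ->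
  exists y, [/\ middle_thirds R y, y != x & `|x - y| <= 3^-1 ^+ n].
Proof.
elim: n x => [x mx|n IH x].
  have [m0 m1] := middle_thirds_ends; have x01 := middle_thirds01 mx.
  rewrite expr0; have [->|x0] := eqVneq x 0.
    by exists 1; split; rewrite ?oner_eq0// sub0r normrN normr1.
  by exists 0; split; rewrite 1?eq_sym// subr0 ger0_norm; lra.
move=> /middle_thirdsP[] /IH[y [my yx xy]].
- exists (y / 3); split.
  + by apply/middle_thirdsP; left; congr middle_thirds: my; field.
  + by apply: contra yx => /eqP <-; apply/eqP; field.
  + have -> : x - y / 3 = 3^-1 * (3 * x - y) by field.
    by rewrite normrM exprS gtr0_norm ?ler_pM2l.
- exists ((y + 2) / 3); split.
  + by apply/middle_thirdsP; right; congr middle_thirds: my; field.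
  + by apply: contra yx => /eqP <-; apply/eqP; field.
  + have -> : x - (y + 2) / 3 = 3^-1 * (3 * x - 2 - y) by field.
    by rewrite normrM exprS gtr0_norm ?ler_pM2l.
Qed.

(** Step [n] is made of intervals of length 3^-n, so two points farther apart lie in different ones.
    Points in the same outer third are rescaled to step n - 1. *)
Lemma cantor_step_gap n x y : cantor_step n x -> cantor_step n y ->
  3^-1 ^+ n < y - x -> exists c, [/\ x < c, c < y & ~ cantor_step n c].
Proof.
elim: n x y => [x y /cantor_step01 ? /cantor_step01 ?|n IH x y].
  by rewrite expr0; lra.
have e0 : 0 <= (3^-1 : R) ^+ n by rewrite exprn_ge0.
rewrite exprS => /cantor_stepS[] cx /cantor_stepS[] cy xy;
  have := cantor_step01 cx; have := cantor_step01 cy => y01 x01.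
- have [|c [xc cy' nc]] := IH _ _ cx cy; first lra.
  exists (c / 3); split; [lra..|] => /cantor_stepS[] h.
    by apply: nc; congr cantor_step: h; field.
  by have := cantor_step01 h; lra.
(* [x] is in the left third and [y] in the right one, so the centre of the removed middle third
   separates them. *)
- exists (1 / 2); split; [lra..|] => /cantor_stepS[] /cantor_step01; lra.
- by lra.
- have [|c [xc cy' nc]] := IH _ _ cx cy; first lra.
  exists ((c + 2) / 3); split; [lra..|] => /cantor_stepS[] h.
    by have := cantor_step01 h; lra.
  by apply: nc; congr cantor_step: h; field.
Qed.

Lemma exists_expr3V_lt (e : R) : 0 < e -> exists n, 3^-1 ^+ n < e.
Proof.
move=> e0.
have /cvgr0Pnorm_lt/(_ _ e0)[n _ /(_ n (leqnn n))] :
    (fun n => (3^-1 : R) ^+ n) @ \oo --> (0 : R).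
  by apply: cvg_expr; rewrite gtr0_norm// invf_lt1// ltr1n.
by rewrite ger0_norm ?exprn_ge0//; exists n.
Qed.

Lemma cantor_like_middle_thirds : cantor_like (set_type (middle_thirds R)).
Proof.
apply: (@cantor_like_set_type R).
- exact: Rhausdorff.
- exact: compact_middle_thirds.
- move=> x e mx /exists_expr3V_lt[n ne].
  have [y [my yx xy]] := middle_thirds_close n mx.
  by exists y; split => //; exact: le_lt_trans ne.
- have sep x y : middle_thirds R x -> middle_thirds R y -> x < y ->
      exists c, [/\ x < c, c < y & forall z, middle_thirds R z -> z != c].
    move=> mx my; rewrite -subr_gt0 => /exists_expr3V_lt[n].
    move=> /(cantor_step_gap (mx n I) (my n I))[c [xc cy nc]].
    exists c; split=> // z mz; apply/eqP => zc.
    by apply: nc; rewrite -zc; exact: mz.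
  move=> x y mx my; rewrite neq_lt => /orP[xy|yx].
    have [c [xc cy cP]] := sep _ _ mx my xy.
    by exists id, c; split=> // z; exact: cvg_id.
  have [c [yc cx cP]] := sep _ _ my mx yx.
  exists -%R, (- c); split; rewrite ?ltrN2//; first exact: oppr_continuous.
  by move=> z mz; rewrite eqr_opp cP.
Qed.

Lemma cantor_like_is_cantor_set (T : pseudoMetricType R) :
  T -> cantor_like T -> is_cantor_set R T.
Proof.
move=> t clT; apply: homeomorphic_trans (cantor_like_homeomorphic t clT) _.
apply: homeomorphic_sym; apply: (@cantor_like_homeomorphic R).
  by exists 0; apply/mem_set; exact: middle_thirds_ends.1.
exact: cantor_like_middle_thirds.
Qed.

End middle_thirds.

(** * Euclidean neighbourhoods, thickenings and orthogonal projections *)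

Section euclidean_topology.
Context {R : realType} {N : nat}.
Implicit Types (u v x y z : 'rV[R]_N) (L : {vspace 'rV[R]_N}) (e r : R).

(** The Euclidean ball lies in the sup-norm ball of the same radius; the converse is continuity of
    the Euclidean distance. *)
Lemma nbhs_euclidP x (A : set 'rV[R]_N) :
  nbhs x A <-> exists2 e, 0 < e & forall y, euclid_dist x y < e -> A y.
Proof.
split=> [/nbhs_ballP[e /= e0 xeA]|[e e0 eA]].
  exists e => // y xy; apply: xeA; split=> // i j; rewrite ord1 /ball/=.
  apply: le_lt_trans xy; have := coord_le_enorm (x - y) j.
  by rewrite !mxE.
apply: (@filterS _ (nbhs x) _ (euclid_dist x @^-1` [set r | r < e])).
  exact: eA.
apply: euclid_dist_continuous; apply: open_nbhs_nbhs.
by split; [exact: open_lt|rewrite /= euclid_distxx].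
Qed.

Lemma lipschitz_euclid_continuous (f : 'rV[R]_N -> 'rV[R]_N) :
  (forall x y, euclid_dist (f x) (f y) <= euclid_dist x y) -> continuous f.
Proof.
move=> lf x A /nbhs_euclidP[e e0 eA]; apply/nbhs_euclidP; exists e => // y xy.
by apply: eA; exact: le_lt_trans (lf _ _) xy.
Qed.

Lemma dotpN u v : dotp (- u) v = - dotp u v.
Proof. by rewrite -scaleN1r dotpZl mulN1r. Qed.

Lemma abs_dotp_le u v : `|dotp u v| <= enorm u * enorm v.
Proof.
rewrite ler_norml cauchy_schwarz andbT lerNl -dotpN -[enorm u]enormN.
exact: cauchy_schwarz.
Qed.

Lemma dotp_euclid_dist x y u :
  `|dotp x u - dotp y u| <= euclid_dist x y * enorm u.
Proof. by rewrite -dotpBl; exact: abs_dotp_le. Qed.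

Lemma dotpl_continuous u : continuous (fun x => dotp x u).
Proof.
move=> x A /nbhs_ballP[e /= e0 eA].
have u1 : 0 < enorm u + 1 by rewrite ltr_wpDl ?enorm_ge0.
apply/nbhs_euclidP; exists (e / (enorm u + 1)); first exact: divr_gt0.
move=> y; rewrite ltr_pdivlMr// => xy; apply: eA; rewrite /ball/=.
apply: le_lt_trans (dotp_euclid_dist _ _ _) (le_lt_trans _ xy).
by rewrite ler_wpM2l ?enorm_ge0// lerDl.
Qed.

Lemma enormZ (a : R) u : enorm (a *: u) = `|a| * enorm u.
Proof.
by rewrite /enorm dotpZl dotpZr mulrA -expr2 sqrtrM ?sqr_ge0// sqrtr_sqr.
Qed.

Lemma dotp_delta i u : dotp (delta_mx 0 i) u = u 0 i.
Proof.
rewrite /dotp (bigD1 i)//= mxE !eqxx mul1r big1 ?addr0// => j ji.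
by rewrite mxE (negbTE ji) andbF mul0r.
Qed.

Lemma enorm_delta i : enorm (delta_mx 0 i : 'rV[R]_N) = 1.
Proof. by rewrite /enorm dotp_delta mxE !eqxx sqrtr1. Qed.

Lemma enorm0 : enorm (0 : 'rV[R]_N) = 0.
Proof. by have := euclid_distxx (0 : 'rV[R]_N); rewrite /euclid_dist subr0. Qed.

Lemma enorm_gt0 u : (0 < enorm u) = (u != 0).
Proof. by rewrite sqrtr_gt0 lt_def dotp_ge0 andbT dotp_eq0. Qed.

Lemma enorm_le_sum u : enorm u <= \sum_(i < N) `|u 0 i|.
Proof.
rewrite {1}[u]row_sum_delta.
elim/big_ind2 : _ => [|a b c d ab cd|i _]; first by rewrite enorm0.
- by apply: le_trans (enormD _ _) _; exact: lerD.
- by rewrite enormZ enorm_delta mulr1.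
Qed.

Lemma compact_closed_ball_euclid r : compact [set v : 'rV[R]_N | enorm v <= r].
Proof.
apply: bounded_closed_compact.
  exists r; split; first exact: num_real.
  move=> M rM v /= vr.
  apply: le_trans (ltW rM); apply: le_trans vr.
  rewrite [leLHS]mx_normrE; apply: bigmax_le; first exact: enorm_ge0.
  by move=> [i j] _ /=; rewrite ord1; exact: coord_le_enorm.
have -> : [set v : 'rV[R]_N | enorm v <= r] =
    euclid_dist 0 @^-1` [set s | s <= r].
  by apply/seteqP; split=> v /=; rewrite /euclid_dist sub0r enormN.
apply: closed_comp; last exact: closed_le.
by move=> x _; exact: euclid_dist_continuous.
Qed.

(** The thickening is the Minkowski sum of [X] and a closed ball, hence the image of a compact
    product under addition. *)
Lemma compact_thickening (X : set 'rV[R]_N) r : compact X ->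
  compact [set y | exists2 x, X x & euclid_dist x y <= r].
Proof.
move=> cX.
have -> : [set y | exists2 x, X x & euclid_dist x y <= r] =
    (fun xv : 'rV[R]_N * 'rV[R]_N => xv.1 + xv.2) @`
      (X `*` [set v | enorm v <= r]).
  apply/seteqP; split=> [y [x Xx xy]|_ [[x v] [/= Xx vr] <-]] /=.
    exists (x, y - x); last by rewrite /= addrC subrK.
    by split => //=; rewrite -enormN opprB.
  by exists x; rewrite // /euclid_dist opprD addrA subrr sub0r enormN.
apply: continuous_compact.
  by apply: continuous_subspaceT => x; exact: add_continuous.
by apply: compact_setX => //; exact: compact_closed_ball_euclid.
Qed.

Lemma dotp_orth_proj L x u : u \in L -> dotp (orth_proj L x) u = dotp x u.
Proof.
have [_ h] := orth_projP L x => uL.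
by apply/esym/eqP; rewrite -subr_eq0 -dotpBl h.
Qed.

Lemma orth_proj_mem L x : orth_proj L x \in L.
Proof. by have [] := orth_projP L x. Qed.

(** The difference p of the projections lies in [L], so |p|^2 = <x - y, p> <= |x - y| |p|; divide by
    |p|. *)
Lemma euclid_dist_orth_proj L x y :
  euclid_dist (orth_proj L x) (orth_proj L y) <= euclid_dist x y.
Proof.
rewrite /euclid_dist; set p := orth_proj L x - _.
have pL : p \in L by apply: rpredB; exact: orth_proj_mem.
have pp : dotp p p = dotp (x - y) p.
  by rewrite [LHS]dotpBl [RHS]dotpBl !dotp_orth_proj.
have [->|p0] := eqVneq p 0; first by rewrite enorm0 enorm_ge0.
rewrite -(ler_pM2r (_ : 0 < enorm p)) ?enorm_gt0//.
by rewrite -expr2 sqr_sqrtr ?dotp_ge0// pp; exact: cauchy_schwarz.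
Qed.

Lemma orth_proj_continuous L : continuous (orth_proj L).
Proof. exact/lipschitz_euclid_continuous/euclid_dist_orth_proj. Qed.

Lemma orth_proj_fullv x : orth_proj fullv x = x.
Proof.
apply/eqP; rewrite eq_sym -subr_eq0 -dotp_eq0; apply/eqP.
by have [_ ->//] := orth_projP fullv x; rewrite ?memvf.
Qed.

End euclidean_topology.

(** * The Baire property of the hyperspace *)

Section hyperspace_baire.
Context {R : realType} {N : nat}.
Local Notation K := (hyperspace R N).
Implicit Types (X Y : K) (e r : R).

Lemma mdist_lt_near X Y e : mdist X Y < e ->
  forall x, hyperspace_set X x ->
    exists2 y, hyperspace_set Y y & euclid_dist x y < e.
Proof.
have [X0 cX] := (hyperspace_neq0 X, @hyperspace_compact _ _ X).
have [Y0 cY] := (hyperspace_neq0 Y, @hyperspace_compact _ _ Y).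
move=> /(hausdorff_dist_lt _ X0 cX Y0 cY)[d de [_ XY _]] x /XY.
by move=> /(set_dist_lt _ _ Y0)[y Yy xy]; exists y => //; exact: lt_trans de.
Qed.

Lemma mdist_le X Y e :
  (forall x, hyperspace_set X x ->
    exists2 y, hyperspace_set Y y & euclid_dist x y <= e) ->
  (forall y, hyperspace_set Y y ->
    exists2 x, hyperspace_set X x & euclid_dist y x <= e) ->
  mdist X Y <= e.
Proof.
move=> XY YX; rewrite leNgt; apply/negP => eD.
have [X0 cX] := (hyperspace_neq0 X, @hyperspace_compact _ _ X).
have [Y0 cY] := (hyperspace_neq0 Y, @hyperspace_compact _ _ Y).
have e0 : 0 <= e.
  by have [x /XY[y _]] := X0; apply: le_trans; exact: enorm_ge0.
suff : mdist X Y < mdist X Y by rewrite ltxx.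
(* The midpoint exceeds [e], hence is an admissible radius for the strict fattenings, yet is below
   the distance. *)
apply/(hausdorff_dist_lt _ X0 cX Y0 cY); exists ((e + mdist X Y) / 2).
  by lra.
split; first lra.
- move=> x /XY[y Yy xy]; apply/set_dist_lt => //; exists y => //.
  by apply: le_lt_trans xy _; lra.
- move=> y /YX[x Xx yx]; apply/set_dist_lt => //; exists x => //.
  by apply: le_lt_trans yx _; lra.
Qed.

Section nested_balls.
Context {X_ : nat -> K} {r_ : nat -> R}.
Context (nested : forall n, mdist (X_ n) (X_ n.+1) + r_ n.+1 < r_ n).
Context (r_gt0 : forall n, 0 < r_ n).

Let C_ n :=
  [set y | exists2 x, hyperspace_set (X_ n) x & euclid_dist x y <= r_ n].

Let C_decr n m : (n <= m)%N -> C_ m `<=` C_ n.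
Proof.
elim: m => [|m IH]; first by rewrite leqn0 => /eqP ->.
rewrite leq_eqVlt => /predU1P[->//|/IH]; apply: subset_trans => y [x Xx xy].
have xr : mdist (X_ m.+1) (X_ m) < r_ m - r_ m.+1.
  by rewrite metric_sym; have := nested m; lra.
have [z Xz xz] := mdist_lt_near xr Xx.
exists z => //; apply: le_trans (euclid_dist_triangle x z y) _.
by rewrite euclid_distC; lra.
Qed.

Let XC n : X_ n `<=` C_ n.
Proof. by move=> x Xx; exists x => //; rewrite euclid_distxx ltW. Qed.

Let C_closed n : closed (C_ n).
Proof.
apply: (compact_closed rV_hausdorff); apply: compact_thickening.
exact: hyperspace_compact.
Qed.

(* A sequence of points of [X_ n], [X_ n.+1], ... with steps bounded by
   the decrements of [r_] accumulates inside every [C_ m]. *)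
Let C_near n x : hyperspace_set (X_ n) x ->
  exists2 z, (\bigcap_m C_ m) z & euclid_dist x z <= r_ n.
Proof.
move=> Xx.
have step m y : hyperspace_set (X_ m) y ->
    exists z, hyperspace_set (X_ m.+1) z /\ euclid_dist y z <= r_ m - r_ m.+1.
  have yr : mdist (X_ m) (X_ m.+1) < r_ m - r_ m.+1.
    by have := nested m; lra.
  by move=> /(mdist_lt_near yr)[z Xz yz]; exists z; split => //; exact: ltW.
have /choice[next nextP] : forall my : nat * 'rV[R]_N, exists z,
    hyperspace_set (X_ my.1) my.2 ->
    hyperspace_set (X_ my.1.+1) z /\ euclid_dist my.2 z <= r_ my.1 - r_ my.1.+1.
  move=> [m y]; have [Xy|nXy] := pselect (hyperspace_set (X_ m) y);
    last by exists y.
  by have [z ?] := step _ _ Xy; exists z.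
pose w := fix w k := if k is k'.+1 then next ((n + k')%N, w k') else x.
have wX k : hyperspace_set (X_ (n + k)%N) (w k).
  elim: k => [|k IH]; first by rewrite addn0.
  by rewrite addnS; have [] := nextP (_, _) IH.
have wx k : euclid_dist x (w k) <= r_ n - r_ (n + k)%N.
  elim: k => [|k IH]; first by rewrite addn0 subrr euclid_distxx.
  have [_ /= kS] := nextP (_, _) (wX k).
  apply: le_trans (euclid_dist_triangle (w k) _ _) _.
  by rewrite addnS; apply: le_trans (lerD IH kS) _; lra.
have cC : compact (C_ n).
  by apply: compact_thickening; exact: hyperspace_compact.
have [|z [_ cz]] := cC (w @ \oo).
  by exists 0%N => // k _; apply: (C_decr (leq_addr k n)); exact: XC.
have limE (E : set 'rV[R]_N) : closed E ->
    (\forall k \near \oo, E (w k)) -> E z.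
  move=> cE Ew; apply: cE => B Bz; exact: cz.
exists z; first move=> m _.
  apply: limE => //; exists m => // k /= mk.
  apply: (@C_decr m (n + k)%N); last exact: XC.
  by rewrite (leq_trans mk)// leq_addl.
apply: (limE (euclid_dist x @^-1` [set s | s <= r_ n])).
  apply: closed_comp; last exact: closed_le.
  by move=> y _; exact: euclid_dist_continuous.
by exists 0%N => // k _ /=; apply: le_trans (wx k) _; rewrite lerBlDr lerDl ltW.
Qed.

(** This replaces completeness. The common point is the intersection of the [C_ m]: its points are
    within [r_ n] of [X_ n] by definition of [C_ n], and [C_near] gives the other direction and
    non-emptiness. *)
Lemma nested_hyperspace_balls : exists Y, forall n, mdist (X_ n) Y <= r_ n.
Proof.
have C0 : (\bigcap_m C_ m) !=set0.
  by have [x /C_near[z Cz _]] := hyperspace_neq0 (X_ 0%N); exists z.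
have cC : compact (\bigcap_m C_ m).
  apply: (@subclosed_compact _ _ (C_ 0%N)); first exact: closed_bigI.
    by apply: compact_thickening; exact: hyperspace_compact.
  by move=> x /(_ 0%N I).
exists (Hyperspace C0 cC) => n; apply: mdist_le; first exact: C_near.
by move=> y /= /(_ n I)[x Xx xy]; exists x; rewrite // euclid_distC.
Qed.

End nested_balls.

Lemma hyperspace_baire (U : nat -> set K) :
  (forall n, open (U n)) -> (forall n, dense (U n)) -> dense (\bigcap_n U n).
Proof.
move=> oU dU O O0 oO.
(* An open ball inside both sets contains the closed ball of half its radius, which is what the
   nested construction needs. *)
have shrink (V W : set K) : open V -> open W -> V !=set0 -> dense W ->
    exists Xr : K * R, 0 < Xr.2 /\
      forall Y, mdist Xr.1 Y <= Xr.2 -> V Y /\ W Y.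
  move=> oV oW V0 dW; have [X VWX] := dW _ V0 oV.
  have : nbhs X (V `&` W) by apply: open_nbhs_nbhs; split => //; exact: openI.
  move=> /nbhs_ballP[e /= e0 eVW]; exists (X, e / 2); split;
    first by rewrite divr_gt0.
  move=> Y /= XY; apply: eVW; rewrite ballEmdist/=.
  by apply: le_lt_trans XY _; lra.
have /choice[next nextP] : forall nXr : nat * (K * R), exists Xr : K * R,
    0 < nXr.2.2 -> [/\ 0 < Xr.2, mdist nXr.2.1 Xr.1 + Xr.2 < nXr.2.2 &
      forall Y, mdist Xr.1 Y <= Xr.2 -> U nXr.1 Y].
  move=> [n [X r]]; have [r0|] := pselect (0 < r); last by exists (X, r).
  have [||[Z s] [/= s0 ZsP]] := shrink _ _ (@open_interior _ (ball X r)) (oU n).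
  - by exists X; exact: nbhsx_ballx.
  - exact: dU.
  (* The bound [s] keeps the new closed ball inside [U n]; the other one uses only half of the room
     left in the old ball, so the nesting is strict. *)
  exists (Z, Num.min s ((r - mdist X Z) / 2)) => _.
  have : mdist X Z < r.
    have [] := ZsP Z; first by rewrite mdistxx ltW.
    by move=> /interior_subset; rewrite ballEmdist.
  move=> XZr; split => /=.
  - by rewrite lt_min s0/=; lra.
  - have : Num.min s ((r - mdist X Z) / 2) <= (r - mdist X Z) / 2.
      by rewrite ge_min lexx orbT.
    by lra.
  - by move=> Y; rewrite le_min => /andP[/ZsP[]].
have [X0r0 [r00 X0P]] := shrink _ _ oO (oU 0%N) O0 (dU 0%N).
pose s := fix s k := if k is k'.+1 then next (k', s k') else X0r0.
have s0 k : 0 < (s k).2 by elim: k => //= k /(nextP (k, s k))[].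
have sS k := nextP (k, s k) (s0 k).
have [|//|Y sY] :=
  nested_hyperspace_balls (X_ := fun k => (s k).1) (r_ := fun k => (s k).2).
  by move=> k; have [] := sS k.
exists Y; split; first by have [] := X0P Y (sY 0%N).
(* Index shift: the ball chosen inside [U n] is the one numbered n + 1. *)
by move=> n _; have [_ _] := sS n; apply; exact: (sY n.+1).
Qed.

End hyperspace_baire.

(** * Generic compact sets and their projections *)

Section generic_compacts.
Context {R : realType} {N : nat}.
Local Notation K := (hyperspace R N).
Implicit Types (X F : K) (u x y : 'rV[R]_N) (a c e r : R).

(** Quantifying over vectors [u] treats all subspaces at once: any non-zero [u] in [L] shows that
    [x] and [y] have distinct projections onto [L]. *)
Definition hyperplane_spread X e := forall x u, hyperspace_set X x -> u != 0 ->
  exists y, [/\ hyperspace_set X y, euclid_dist x y < e & dotp y u != dotp x u].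

(** Bounding |u| by [r] makes the gaps stable: moving [x] by d changes <x, u> by at most d r. *)
Definition projection_gaps X e r := forall u a, enorm u <= r ->
  exists c, a <= c <= a + e /\ forall x, hyperspace_set X x -> dotp x u != c.

(** The points of [s] are avoided one by one: the first or last third of the interval is at distance
    at least e/6 from [t], and the search continues in that third. The bound depends only on the
    length of [s]. *)
Lemma exists_far_from_seq (s : seq R) a e : 0 < e ->
  exists c, a <= c <= a + e /\
    forall t, t \in s -> e / 6 ^+ size s <= `|c - t|.
Proof.
elim: s a e => [|t s IH] a e e0; first by exists a; split=> //; lra.
have [b [ab bt]] : exists b, a <= b <= a + 2 / 3 * e /\
    forall c, b <= c <= b + e / 3 -> e / 6 <= `|c - t|.
  have [ta|ta] := leP t (a + e / 2); [exists (a + 2 / 3 * e)|exists a];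
    split=> [|c]; try lra.
    by move=> ?; rewrite ger0_norm; lra.
  by move=> ?; rewrite ltr0_norm; lra.
have [|c [bc cs]] := IH b (e / 3); first by rewrite divr_gt0.
have p0 : 0 < (6 : R) ^+ size s by rewrite exprn_gt0.
have p1 : 1 <= (6 : R) ^+ size s by rewrite exprn_ege1// ler1n.
exists c; split=> [|t']; first lra.
rewrite in_cons => /predU1P[->|/cs].
  apply: le_trans (bt _ bc); rewrite /= exprS invfM mulrA ler_pdivrMr//.
  by rewrite ler_peMr// divr_ge0// ltW.
apply: le_trans; rewrite /= exprS invfM mulrA ler_pM2r ?invr_gt0//; lra.
Qed.

(** The products of [u] with [F] form a list of fixed length, so they leave a gap of radius [t]
    uniform in [u] and [a]; passing from [F] to [X] moves products by less than [t]. *)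
Lemma finite_projection_gaps F (s : seq 'rV[R]_N) e r :
  hyperspace_set F = [set` s] -> 0 < e -> 0 <= r ->
  exists2 d : R, 0 < d & forall X, mdist F X < d -> projection_gaps X e r.
Proof.
move=> Fs e0 r0; pose t := e / 6 ^+ size s.
have t0 : 0 < t by rewrite divr_gt0// exprn_gt0.
exists (t / (r + 1)) => [|X FX u a ur]; first by rewrite divr_gt0// ltr_wpDl.
have [c [ac cs]] := exists_far_from_seq [seq dotp f u | f <- s] a e0.
exists c; split=> // x Xx; apply/eqP => xc.
have XF : mdist X F < t / (r + 1) by rewrite metric_sym.
have [f] := mdist_lt_near XF Xx; rewrite Fs /= => fs xf.
have := cs _ (map_f (fun f => dotp f u) fs).
rewrite size_map -/t -xc leNgt => /negP; apply.
apply: le_lt_trans (dotp_euclid_dist _ _ _) _.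
move: xf; rewrite ltr_pdivlMr ?ltr_wpDl//; apply: le_lt_trans.
by rewrite ler_wpM2l ?enorm_ge0//; lra.
Qed.

(* If all points of [X] near [x] had the same product with [u], then the points
   of [X] near [g] and the [g + s *: e_i] would force all the coordinates of [u]
   to be small compared with its norm. *)
Lemma simplices_hyperplane_spread F (s : R) : 0 < s ->
  (forall f, hyperspace_set F f -> exists g, [/\ hyperspace_set F g,
     euclid_dist f g <= s &
     forall i, hyperspace_set F (g + s *: delta_mx 0 i)]) ->
  exists2 d : R, 0 < d &
    forall X, mdist F X < d -> hyperplane_spread X (3 * s).
Proof.
(* Summing the coordinate bounds will give s |u| <= 2 d N |u|, which contradicts 2 d (N + 1) = s. *)
move=> s0 hF; pose d := s / (2 * N.+1%:R).
have N0 : 0 < (N.+1%:R : R) by rewrite ltr0n.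
have d0 : 0 < d by rewrite divr_gt0// mulr_gt0.
have ds : d * (2 * N.+1%:R) = s by rewrite divfK// gt_eqF// mulr_gt0.
have ds2 : 2 * d <= s.
  rewrite -ds mulrC ler_wpM2l ?(ltW d0)//.
  by rewrite ler_peMr// ler1n.
exists d => // X FX x u Xx u0; apply: contrapT => /forallNP same.
have XF : mdist X F < d by rewrite metric_sym.
have [f Ff xf] := mdist_lt_near XF Xx.
have [g [Fg fg Fgs]] := hF _ Ff.
have near_const z : hyperspace_set F z -> euclid_dist g z <= s ->
    `|dotp z u - dotp x u| <= d * enorm u.
  move=> Fz gz; have [y Xy zy] := mdist_lt_near FX Fz.
  (* The path from [x] to [y] through [f], [g], [z] has length below d + s + s + d, at most 3 s by
     [ds2]. So [same] applies to [y]. *)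
  have xy : euclid_dist x y < 3 * s.
    apply: le_lt_trans (euclid_dist_triangle f x y) _.
    have := euclid_dist_triangle g f y; have := euclid_dist_triangle z g y.
    by lra.
  have <- : dotp y u = dotp x u.
    by apply/eqP/negPn/negP => ne; apply: (same y); split.
  apply: le_trans (dotp_euclid_dist _ _ _) _.
  by rewrite ler_wpM2r ?enorm_ge0// ltW.
have coord i : s * `|u 0 i| <= 2 * d * enorm u.
  have gi : euclid_dist g (g + s *: delta_mx 0 i) <= s.
    by rewrite /euclid_dist opprD addrA subrr sub0r enormN enormZ enorm_delta
      mulr1 gtr0_norm.
  have := near_const _ (Fgs i) gi.
  have := near_const _ Fg; rewrite euclid_distxx => /(_ (ltW s0)).
  rewrite dotpDl dotpZl dotp_delta -[s in s * `|_|]gtr0_norm// -normrM.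
  by rewrite !ler_norml; lra.
have : s * enorm u <= 2 * d * N%:R * enorm u.
  apply: le_trans (_ : s * \sum_(i < N) `|u 0 i| <= _).
    by rewrite ler_pM2l// enorm_le_sum.
  rewrite mulr_sumr (le_trans (ler_sum _ (fun i _ => coord i)))//.
  by rewrite sumr_const card_ord -mulr_natr; lra.
rewrite ler_pM2r ?enorm_gt0// -ds -natr1; lra.
Qed.

Lemma finite_net X e : 0 < e -> exists D : seq 'rV[R]_N,
  (forall g, g \in D -> hyperspace_set X g) /\
  forall x, hyperspace_set X x -> exists2 g, g \in D & euclid_dist g x < e.
Proof.
move=> e0; have := @hyperspace_compact _ _ X; rewrite compact_cover.
move=> /(_ _ (hyperspace_set X) (fun x => euclid_dist x @^-1` [set a | a < e])).
case=> [x _||D DX Dcov].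
- apply: open_comp; last exact: open_lt.
  by move=> y _; exact: euclid_dist_continuous.
- by move=> x Xx; exists x; rewrite //= euclid_distxx.
exists (finmap.enum_fset D); split=> [g gD|x /Dcov[g gD gx]]; last by exists g.
exact/set_mem/DX.
Qed.

(** [F] is a finite [e]-net of [X] with the vertices g + s e_i added to each net point g. The net
    makes it close to [X], and the added vertices give full-dimensional simplices. *)
Lemma exists_simplices_near X e s : 0 < s -> s < e ->
  exists F : K, exists t : seq 'rV[R]_N, [/\ hyperspace_set F = [set` t],
    mdist X F < 3 * e &
    forall f, hyperspace_set F f -> exists g, [/\ hyperspace_set F g,
      euclid_dist f g <= s &
      forall i, hyperspace_set F (g + s *: delta_mx 0 i)]].
Proof.
move=> s0 se; have e0 : 0 < e by exact: lt_trans se.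
have [D [DX Dcov]] := finite_net X e0.
pose vs : seq 'rV[R]_N := 0 :: [seq s *: delta_mx 0 i | i <- enum 'I_N].
pose t := [seq g + v | g <- D, v <- vs].
have tP g v : g \in D -> v \in vs -> g + v \in t.
  by move=> gD vv; apply/allpairsP; exists (g, v).
have t0 g : g \in D -> g \in t by move=> gD; rewrite -[g]addr0 tP// mem_head.
have ti g i : g \in D -> g + s *: delta_mx 0 i \in t.
  move=> gD; apply: tP => //; rewrite in_cons; apply/orP; right.
  by apply/mapP; exists i; rewrite ?mem_enum.
have vs_small v : v \in vs -> enorm v <= s.
  rewrite in_cons => /predU1P[->|/mapP[i _ ->]]; first by rewrite enorm0 ltW.
  by rewrite enormZ enorm_delta mulr1 gtr0_norm.
have tD f : f \in t -> exists2 g, g \in D & euclid_dist f g <= s.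
  move=> /allpairsP[[g v] /= [gD vv ->]]; exists g => //.
  by rewrite /euclid_dist addrAC subrr add0r vs_small.
have tn0 : [set` t] !=set0.
  have [x /Dcov[g gD _]] := hyperspace_neq0 X.
  by exists g => /=; exact: t0.
have tc : compact [set` t] by apply: finite_compact; exact: finite_seq.
exists (Hyperspace tn0 tc), t; split=> //=.
- apply: (@le_lt_trans _ _ (2 * e)); last lra.
  apply: mdist_le => [x /Dcov[g gD gx]|f /= /tD[g gD fg]].
    by exists g; [exact: t0|rewrite euclid_distC; lra].
  by exists g; [exact: DX|lra].
- move=> f /tD[g gD fg]; exists g; split=> //; first exact: t0.
  by move=> i; exact: ti.
Qed.

Definition generic_at n : set K := [set X |
  hyperplane_spread X n.+1%:R^-1 /\ projection_gaps X n.+1%:R^-1 n.+1%:R].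

Lemma dense_interior_generic_at n : dense (generic_at n)^°.
Proof.
move=> O [X OX] oO.
have : nbhs X O by exact: open_nbhs_nbhs.
move=> /nbhs_ballP[e /= e0 eO].
have n0 : 0 < (n.+1%:R : R)^-1 by rewrite invr_gt0 ltr0n.
(* The first bound gives s < e/3, so that [F] is found within 3 (e/3) = e of [X]; the second makes
   the spread 3 s at most 1/(n+1). *)
pose s : R := Num.min (e / 6) (n.+1%:R^-1 / 3).
have s0 : 0 < s by rewrite lt_min !divr_gt0.
have se : s < e / 3.
  by apply: (@le_lt_trans _ _ (e / 6)); [rewrite ge_min lexx|lra].
have sn : 3 * s <= n.+1%:R^-1.
  by rewrite mulrC -ler_pdivlMr// ge_min lexx orbT.
have [F [t [Ft XF Fsimp]]] := exists_simplices_near X s0 se.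
have [d1 d10 spread] := simplices_hyperplane_spread s0 Fsimp.
have [d2 d20 gaps] := finite_projection_gaps Ft n0 (ler0n _ n.+1).
exists F; split; first by apply: eO; rewrite ballEmdist/=; lra.
apply/nbhs_ballP; exists (Num.min d1 d2); first by rewrite /= lt_min d10.
move=> Y; rewrite ballEmdist/= lt_min => /andP[FY1 FY2].
split; last exact: gaps.
move=> x u Yx u0; have [y [Yy xy yu]] := spread _ FY1 _ _ Yx u0.
by exists y; split=> //; exact: lt_le_trans sn.
Qed.

Lemma generic_orth_proj_cantor X (L : {vspace 'rV[R]_N}) :
  (forall n, generic_at n X) -> L != 0%VS ->
  is_cantor_set R (set_type (orth_proj L @` X)).
Proof.
move=> gX L0; have [x0 Xx0] := hyperspace_neq0 X.
apply: cantor_like_is_cantor_set.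
  by exists (orth_proj L x0); apply/mem_set; exists x0.
have small (e : R) : 0 < e -> exists m, forall n, (m <= n)%N -> n.+1%:R^-1 < e.
  move=> e0; exists (Num.truncn e^-1) => n mn.
  rewrite invf_plt ?posrE ?ltr0n//; apply: lt_le_trans (truncnS_gt _) _.
  by rewrite ler_nat ltnS.
apply: cantor_like_set_type.
- exact: rV_hausdorff.
- apply: continuous_compact; last exact: hyperspace_compact.
  exact/continuous_subspaceT/orth_proj_continuous.
- move=> _ e [x Xx <-] e0.
  have /nbhs_euclidP[d d0 dball] := nbhsx_ballx (orth_proj L x) e e0.
  have [n /(_ n (leqnn n)) nd] := small _ d0.
  have uL := memv_pick L; set u := vpick L in uL.
  have [|y [Xy xy yu]] := (gX n).1 x u Xx; first by rewrite vpick0.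
  exists (orth_proj L y); split; first by exists y.
    apply: dball; apply: le_lt_trans (euclid_dist_orth_proj _ _ _) _.
    exact: lt_trans nd.
  apply: contra yu => /eqP pxy.
  by rewrite -(dotp_orth_proj x uL) -(dotp_orth_proj y uL) pxy.
- move=> p q [x Xx xp] [y Xy yq] pq; pose u := q - p.
  have uL : u \in L by rewrite /u -yq -xp rpredB// orth_proj_mem.
  have pqu : 0 < dotp q u - dotp p u.
    by rewrite -dotpBl dotp_gt0// subr_eq0 eq_sym.
  have pqu2 : 0 < (dotp q u - dotp p u) / 2 by rewrite divr_gt0.
  have [m mpq] := small _ pqu2.
  (* One index serves both purposes: 1/(n+1) is below half the difference of the two products, and n
     + 1 bounds |u|. The interval starting at the midpoint of the products then ends before <q, u>,
     so its gap [c] lies strictly between them. *)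
  pose n := maxn m (Num.truncn (enorm u)).
  have npq : n.+1%:R^-1 < (dotp q u - dotp p u) / 2.
    by apply: mpq; rewrite leq_maxl.
  have nu : enorm u <= n.+1%:R.
    apply: le_trans (ltW (truncnS_gt _)) _.
    by rewrite ler_nat ltnS leq_maxr.
  have [c [ac cX]] := (gX n).2 u ((dotp q u + dotp p u) / 2) nu.
  exists (fun z => dotp z u), c; split.
  + exact: dotpl_continuous.
  + by clear -ac pqu; lra.
  + case/andP: ac => _ cu; apply: le_lt_trans cu _; rewrite -ltrBrDl.
    by apply: lt_le_trans npq _; lra.
  + by move=> _ [z Xz <-]; rewrite dotp_orth_proj// cX.
Qed.

End generic_compacts.

Theorem corollary1p2 (R : realType) (N : nat) (hN : (1 <= N)%N) :
  exists A : set (hyperspace R N),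
    [/\ dense A, Gdelta A &
        forall X : hyperspace R N, A X ->
          is_cantor_set R (set_type (X : set 'rV[R]_N)) /\
          forall L : {vspace 'rV[R]_N}, L != 0%VS ->
            is_cantor_set R (set_type (orth_proj L @` X))].
Proof.
exists (\bigcap_n (@generic_at R N n)^°); split.
- by apply: hyperspace_baire => n; [exact: open_interior|
    exact: dense_interior_generic_at].
- by exists (fun n => (@generic_at R N n)^°) => [n|//]; exact: open_interior.
move=> X AX; have gX n : generic_at n X.
  exact: interior_subset (AX n I).
split=> [|L]; last exact: generic_orth_proj_cantor.
(* [X] is its own projection onto the whole space, which is non-zero as N >= 1; so the claim about
   projections covers [X] as well. *)
have <- : orth_proj fullv @` X = X :> set 'rV[R]_N.
  rewrite -[RHS]image_id; apply: eq_imagel => x _.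
  by rewrite orth_proj_fullv.
apply: generic_orth_proj_cantor => //.
by rewrite -dimv_eq0 dimvf dim_matrix mul1r -lt0n.
Qed.
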